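(* Let $V$ be a $\mathbb{Q}[\operatorname{SL}_2(\mathbb{Z})]$-module. Suppose that for every unipotent element $u \in \operatorname{SL}_2(\mathbb{Z})$ one has $(u-1)^5 = 0$ in $\operatorname{End} V$. Then $V$ has a finite series of $\mathbb{Q}[\operatorname{SL}_2(\mathbb{Z})]$-submodules $0 = V_0 \leq V_1 \leq \dots \leq V_m = V$ (a composition series in the paper's sense) each factor $V_j/V_{j-1}$ of which is a direct sum of copies of $\mathbb{Q}\otimes_\mathbb{Z} \operatorname{Sym}^k \operatorname{Nat} \operatorname{SL}_2(\mathbb{Z})$ for some $k \in \{0, \dots, 4\}$.
   Context: $\operatorname{SL}_2(\mathbb{Z})$ is regarded as an abstract group. $\operatorname{Nat}\operatorname{SL}_2(\mathbb{Z})$ is $\mathbb{Z}^2$ with the natural action, and $\operatorname{Sym}^k \operatorname{Nat} \operatorname{SL}_2(\mathbb{Z})$ its $k$-th symmetric power; thus $\mathbb{Q}\otimes_\mathbb{Z} \operatorname{Sym}^k \operatorname{Nat} \operatorname{SL}_2(\mathbb{Z})$ is the $(k+1)$-dimensional $\mathbb{Q}$-space of homogeneous polynomials of degree $k$ in $X,Y$, with the usual action of $\operatorname{SL}_2(\mathbb{Z})\leq \operatorname{SL}_2(\mathbb{Q})$ by linear substitution. *)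

(* Defs.v *)
From HB Require Import structures.
From mathcomp Require Import all_boot all_order all_algebra.
Set Implicit Arguments. Unset Strict Implicit. Unset Printing Implicit Defensive.
Import Order.TTheory GRing.Theory Num.Theory.
Local Open Scope ring_scope.

Definition inSL2 (g : 'M[int]_2) : Prop := \det g = 1.

Definition unipotent (u : 'M[int]_2) : Prop :=
  inSL2 u /\ exists n : nat, (u - 1) ^+ n = 0.

Definition is_SL2_action (V : lmodType rat) (rho : 'M[int]_2 -> V -> V) : Prop :=
  [/\ (forall g, inSL2 g -> forall (a : rat) (x y : V),
          rho g (a *: x + y) = a *: rho g x + rho g y),
      (forall x, rho 1 x = x) &
      (forall g h, inSL2 g -> inSL2 h -> forall x, rho (g * h) x = rho g (rho h x))].

Definition is_submodule (V : lmodType rat) (rho : 'M[int]_2 -> V -> V)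
    (W : V -> Prop) : Prop :=
  [/\ W 0,
      (forall (a : rat) x y, W x -> W y -> W (a *: x + y)) &
      (forall g x, inSL2 g -> W x -> W (rho g x))].

(** Q (x) Sym^k Nat SL_2(Z): homogeneous polynomials of degree k in X, Y,
    encoded as row vectors v : 'rV[rat]_(k+1), v_j = coefficient of X^(k-j) Y^j.
    g = [[a,b],[c,d]] acts by P(X,Y) |-> P(aX + cY, bX + dY) (the natural action
    on Z^2 = column vectors, extended to Sym^k).  Dehomogenizing at X = 1, Y = t:
    the coefficient of X^(k-i)Y^i in (aX+cY)^(k-j) (bX+dY)^j is the coefficient
    of t^i in (a + c t)^(k-j) (b + d t)^j. *)
Definition symk_coef (k : nat) (g : 'M[int]_2) (i j : 'I_k.+1) : rat :=
  let a : rat := (g 0 0)%:~R in let b : rat := (g 0 1)%:~R in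
  let c : rat := (g 1 0)%:~R in let d : rat := (g 1 1)%:~R in
  (((a%:P + c *: 'X) ^+ (k - j)) * ((b%:P + d *: 'X) ^+ j))`_i.

Definition symk_act (k : nat) (g : 'M[int]_2) (v : 'rV[rat]_k.+1) : 'rV[rat]_k.+1 :=
  \row_i \sum_(j < k.+1) v 0 j * @symk_coef k g i j.

Definition fam_sum (V : lmodType rat) (I : Type) (n : nat)
    (f : I -> 'rV[rat]_n -> V) (l : seq (I * 'rV[rat]_n)) : V :=
  \sum_(p <- l) f p.1 p.2.

(** The quotient module W / W' (W' <= W submodules) is isomorphic, as a
    Q[SL_2(Z)]-module, to a direct sum (indexed by I) of copies of
    Q (x) Sym^k Nat.  Written out: there are Q-linear maps f_i : Sym^k -> W
    whose composites with W -> W/W' are SL_2(Z)-equivariant and such that the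
    induced map (+)_{i in I} Sym^k -> W/W' is surjective and injective. *)
Definition quot_iso_sum_symk (V : lmodType rat) (rho : 'M[int]_2 -> V -> V)
    (W' W : V -> Prop) (k : nat) : Prop :=
  exists (I : eqType) (f : I -> {linear 'rV[rat]_k.+1 -> V}),
  [/\ (forall i s, W (f i s)),
      (forall i g s, inSL2 g -> W' (f i (@symk_act k g s) - rho g (f i s))),
      (forall w, W w -> exists l : seq (I * 'rV[rat]_k.+1),
          W' (w - fam_sum (fun i => f i) l)) &
      (forall l : seq (I * 'rV[rat]_k.+1), uniq (map fst l) ->
          W' (fam_sum (fun i => f i) l) -> forall p, p \in l -> p.2 = 0)].

(* Main.v *)
(** The unipotent u = [[1,1],[0,1]] and w = [[0,1],[-1,0]] generate SL_2(Z), and V splits into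
    the two eigenspaces of the central element w^2 = -1.  On the eigenspace of eps, with
    t = u - 1, the group acts through the algebra
      A_eps = Q<t, w> / (t^5, w^2 = eps, (u w)^3 = 1),
    which has dimension 60: replacing t^5 = 0 by u^5 = 1 gives, for eps = 1, the group algebra of
    the triangle group (2,3,5), that is of A_5.  In A = A_eps there is a short chain of two-sided
    ideals 0 = I_0 < I_1 < ... < I_m = A such that I_(j+1) = I_j + A p_j A, where modulo I_j the
    element p_j satisfies the relations of the highest weight vector X^k of Sym^k, with k
    depending on j.  The submodules I_j V form the required series: modulo I_j V every p_j v is
    the image of X^k under an equivariant map from Sym^k, and a maximal family of such vectors
    that is independent modulo I_j V gives a direct sum decomposition, since some power of u - 1
    sends a given nonzero polynomial of Sym^k to a nonzero multiple of X^k. *)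
Require Import Defs.
From HB Require Import structures.
From Stdlib Require Import ZArith.
From mathcomp Require Import all_boot all_order all_algebra.
From mathcomp Require Import boolp classical_sets.
From mathcomp Require Import ssrZ zify ring.
Set Implicit Arguments. Unset Strict Implicit. Unset Printing Implicit Defensive.
Import Order.TTheory GRing.Theory Num.Theory.
Local Open Scope ring_scope.
Delimit Scope Z_scope with BinZ.

(** * Noncommutative polynomials *)

(** Words in the letters t = u - 1 ([false]) and w ([true]).  Polynomials are kept sorted, with
    the leading monomial for the degree-lexicographic order first. *)
Definition word := seq bool.
Definition ncpoly := seq (Z * word).

Fixpoint word_lex (a b : word) : comparison :=
  match a, b with
  | x :: a', y :: b' =>
    match x, y with
    | false, true => Lt
    | true, false => Gt
    | _, _ => word_lex a' b'
    end
  | _, _ => Eq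
  end.

Definition word_cmp (a b : word) : comparison :=
  if Nat.compare (size a) (size b) is Eq then word_lex a b
  else Nat.compare (size a) (size b).

Fixpoint ncadd (p : ncpoly) : ncpoly -> ncpoly :=
  match p with
  | [::] => id
  | (c, a) :: p' =>
    fix aux (q : ncpoly) : ncpoly :=
      match q with
      | [::] => p
      | (d, b) :: q' =>
        match word_cmp a b with
        | Gt => (c, a) :: ncadd p' q
        | Lt => (d, b) :: aux q'
        | Eq => let s := Z.add c d in
          if Z.eqb s 0 then ncadd p' q' else (s, a) :: ncadd p' q'
        end
      end
  end.

Definition ncshift (c : Z) (l : word) (p : ncpoly) (r : word) : ncpoly :=
  [seq (Z.mul c m.1, l ++ m.2 ++ r) | m <- p].

Definition ncscale (c : Z) (p : ncpoly) : ncpoly :=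
  if Z.eqb c 1 then p else [seq (Z.mul c m.1, m.2) | m <- p].

Definition ncsort (p : ncpoly) : ncpoly :=
  foldr (fun m q => if Z.eqb m.1 0 then q else ncadd [:: m] q) [::] p.

Definition ncmul (p q : ncpoly) : ncpoly :=
  foldr (fun m => ncadd (ncshift m.1 m.2 q [::])) [::] p.

Fixpoint unprefix (l w : word) : option word :=
  match l, w with
  | [::], _ => Some w
  | x :: l', y :: w' => if Bool.eqb x y then unprefix l' w' else None
  | _, _ => None
  end.

Fixpoint find_factor (l w : word) : option (word * word) :=
  if unprefix l w is Some r then Some ([::], r)
  else if w is b :: w' then
    if find_factor l w' is Some (a, r) then Some (b :: a, r) else None
  else None.

Fixpoint redex (rules : seq ncpoly) (w : word) : option (ncpoly * Z * word * word) :=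
  match rules with
  | [::] => None
  | g :: rules' =>
    if g is (c, l) :: _ then
      if find_factor l w is Some (a, r) then Some (g, c, a, r)
      else redex rules' w
    else redex rules' w
  end.

(** Fraction-free normal form; [acc] is the irreducible part found so far, in reverse.  Only the
    soundness of this procedure is proved: each step adds a multiple of a rule to a nonzero
    multiple of the input, whatever [redex] returns and wherever [fuel] stops. *)
Fixpoint ncreduce (fuel : nat) (rules : seq ncpoly) (acc p : ncpoly) : ncpoly :=
  match fuel, p with
  | n.+1, (c, w) :: p' =>
    if redex rules w is Some (g, cg, a, r) then
      let d := Z.gcd c cg in
      let u := Z.div cg d in
      if Z.eqb u 0 then catrev acc p else
      ncreduce n rules (ncscale u acc)
        (ncadd (ncscale u p) (ncshift (Z.opp (Z.div c d)) a g r))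
    else ncreduce n rules ((c, w) :: acc) p'
  | _, _ => catrev acc p
  end.

(** Dividing by the content keeps the coefficients small. Exactness of the division is tested at run
    time, so it needs no proof. *)
Definition ncprim (p : ncpoly) : ncpoly :=
  let d := foldr (fun m => Z.gcd m.1) 0%BinZ p in
  let q := [seq (Z.div m.1 d, m.2) | m <- p] in
  if ~~ Z.eqb d 0 && (ncscale d q == p) then q else p.

(** A script runs the part of Buchberger's algorithm that is needed.  [Pair i j k] adds the reduced
    S-polynomial of the rules [i] and [j], where the last [k] letters of the leading word of [i]
    are the first [k] letters of that of [j]; for [k = 0] the leading word of [j] is a factor of
    that of [i].  [Tail i] adds the rule [i] with its non-leading terms reduced. *)
Inductive instr := Pair of nat & nat & nat | Tail of nat.

Definition overlap (f g : ncpoly) (k : nat) : ncpoly :=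
  match f, g with
  | (c, a) :: _, (d, b) :: _ =>
    if k is 0 then
      if find_factor b a is Some (l, r) then
        ncadd (ncshift d [::] f [::]) (ncshift (Z.opp c) l g r)
      else [::]
    else ncadd (ncshift d [::] f (drop k b))
               (ncshift (Z.opp c) (take (size a - k) a) g [::])
  | _, _ => [::]
  end.

Definition fuel := 3000%N.

(** New rules go to the end of the list, so the indices used in a script stay stable. *)
Definition exec (rules : seq ncpoly) (i : instr) : seq ncpoly :=
  rcons rules (ncprim match i with
    | Pair i j k => ncreduce fuel rules [::] (overlap (nth [::] rules i) (nth [::] rules j) k)
    | Tail i => if nth [::] rules i is m :: p then ncreduce fuel rules [:: m] p else [::]
    end).

Definition derives (rules : seq ncpoly) (script : seq instr) (goals : seq ncpoly) : bool :=
  let rules' := foldl exec rules script in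
  all (fun p => nilp (ncreduce fuel rules' [::] p)) goals.

Definition ratZ (c : Z) : rat := (int_of_Z c)%:~R.

Lemma ratZD c d : ratZ (Z.add c d) = ratZ c + ratZ d.
Proof. by rewrite /ratZ (raddfD int_of_Z c d) rmorphD. Qed.

Lemma ratZM c d : ratZ (Z.mul c d) = ratZ c * ratZ d.
Proof. by rewrite /ratZ (rmorphM int_of_Z c d) rmorphM. Qed.

Lemma ratZN c : ratZ (Z.opp c) = - ratZ c.
Proof. by rewrite /ratZ (raddfN int_of_Z c) rmorphN. Qed.

Lemma ratZ_nat n : ratZ (Z.of_nat n) = n%:R.
Proof. by rewrite /ratZ; case: n => //= n; rewrite SuccNat2Pos.id_succ. Qed.

Lemma ratZ_eq0 c : (ratZ c == 0) = Z.eqb c 0.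
Proof.
rewrite /ratZ intr_eq0; case: c => //= p.
by have := Pos2Nat.is_pos p; case: (Pos.to_nat p) => // /Nat.lt_irrefl.
Qed.

(** * Soundness of the computations, modulo a subspace *)

Section Evaluation.
Variables (V : lmodType rat) (t w : {linear V -> V}).

Definition evalw (a : word) (x : V) : V :=
  foldr (fun b y => if b then w y else t y) x a.

Definition evalp (p : ncpoly) (x : V) : V :=
  foldr (fun m y => ratZ m.1 *: evalw m.2 x + y) 0 p.

Lemma evalw_cat a b x : evalw (a ++ b) x = evalw a (evalw b x).
Proof. by rewrite /evalw foldr_cat. Qed.

Lemma evalwP a : linear (evalw a).
Proof. by move=> c x y; elim: a => //= -[] a ->; rewrite linearP. Qed.

HB.instance Definition _ a := GRing.isLinear.Build rat V V _ (evalw a) (evalwP a).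

Lemma evalp_cat p q x : evalp (p ++ q) x = evalp p x + evalp q x.
Proof. by elim: p => [|m p IH] /=; rewrite ?add0r // IH addrA. Qed.

Lemma word_cmpP a b : word_cmp a b = Eq -> a = b.
Proof.
rewrite /word_cmp; case: Nat.compare (Nat.compare_eq_iff (size a) (size b)) => // -[/(_ erefl) + _].
by elim: a b => [|x a IH] [|y b] //= [] /IH{}IH; case: x; case: y => // /IH->.
Qed.

Lemma evalp_add p q x : evalp (ncadd p q) x = evalp p x + evalp q x.
Proof.
elim: p q => [|[c a] p IHp] q; first by rewrite add0r.
elim: q => [|[d b] q IHq] /=; first by rewrite addr0.
case E: (word_cmp a b) => /=.
- rewrite -(word_cmpP E) addrACA -scalerDl -ratZD.
  have := ratZ_eq0 (c + d)%BinZ; case: Z.eqb => /= [/eqP->|_].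
    by rewrite scale0r add0r IHp.
  by rewrite IHp.
- by rewrite [aux in _ + aux _]/= IHq /= addrCA.
- by rewrite IHp addrA.
Qed.

Lemma evalp_shift c l p r x :
  evalp (ncshift c l p r) x = ratZ c *: evalw l (evalp p (evalw r x)).
Proof.
elim: p => [|m p IH] /=; first by rewrite linear0 scaler0.
by rewrite IH !evalw_cat linearP /= ratZM -scalerA scalerDr.
Qed.

Lemma evalp_scale c p x : evalp (ncscale c p) x = ratZ c *: evalp p x.
Proof.
rewrite /ncscale; case: Z.eqb_spec => [->|_]; first by rewrite scale1r.
by elim: p => [|m p IH] /=; rewrite ?scaler0 // IH ratZM -scalerA scalerDr.
Qed.

Lemma evalp_sort p x : evalp (ncsort p) x = evalp p x.
Proof.
elim: p => // m p IH.
rewrite -[ncsort _]/(if Z.eqb m.1 0 then ncsort p else ncadd [:: m] (ncsort p)).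
have := ratZ_eq0 m.1; case: Z.eqb => [/eqP m0|_]; first by rewrite /= m0 scale0r add0r IH.
by rewrite evalp_add IH /= addr0.
Qed.

Lemma evalp_mul p q x : evalp (ncmul p q) x = evalp p (evalp q x).
Proof.
elim: p => // m p IH.
by rewrite -[ncmul _ _]/(ncadd (ncshift m.1 m.2 q [::]) (ncmul p q)) evalp_add evalp_shift IH.
Qed.

Lemma evalp_catrev acc p x : evalp (catrev acc p) x = evalp acc x + evalp p x.
Proof.
by elim: acc p => [|m acc IH] p /=; rewrite ?add0r // IH /= addrA (addrC _ (evalp acc x)).
Qed.

Variables (E X : V -> Prop).
Hypothesis (X0 : X 0) (XP : forall a x y, X x -> X y -> X (a *: x + y)).
Hypothesis (Xt : forall x, X x -> X (t x)) (Xw : forall x, X x -> X (w x)).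
Hypothesis (Et : forall x, E x -> E (t x)) (Ew : forall x, E x -> E (w x)).

Lemma closed_evalw a x : X x -> X (evalw a x).
Proof. by move=> Xx; elim: a => //= -[] a IH; [apply: Xw | apply: Xt]. Qed.

Lemma domain_evalw a x : E x -> E (evalw a x).
Proof. by move=> Ex; elim: a => //= -[] a IH; [apply: Ew | apply: Et]. Qed.

Lemma closed_scale a x : X x -> X (a *: x).
Proof. by move=> Xx; rewrite -[_ *: x]addr0; apply: XP. Qed.

Lemma closed_add x y : X x -> X y -> X (x + y).
Proof. by move=> Xx Xy; rewrite -[x]scale1r; apply: XP. Qed.

Lemma closed_scaleK a x : a != 0 -> X (a *: x) -> X x.
Proof. by move=> a0 /(@closed_scale a^-1); rewrite scalerA mulVf // scale1r. Qed.

(** Such polynomials behave as a two-sided ideal: stability of [X] under t and w gives left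
    multiples, stability of [E] gives right multiples. In the application [E] is an eigenspace of
    w^2 and [X] a submodule. *)
Definition valid (p : ncpoly) : Prop := forall x, E x -> X (evalp p x).

Lemma valid_nil : valid [::].
Proof. by move=> x _. Qed.

Lemma valid_add p q : valid p -> valid q -> valid (ncadd p q).
Proof. by move=> Hp Hq x Ex; rewrite evalp_add; apply: closed_add; [apply: Hp | apply: Hq]. Qed.

Lemma valid_shift c l p r : valid p -> valid (ncshift c l p r).
Proof.
move=> Hp x Ex; rewrite evalp_shift; apply: closed_scale; apply: closed_evalw.
by apply: Hp; apply: domain_evalw.
Qed.

Definition valid_rules (rules : seq ncpoly) := forall p, p \in rules -> valid p.

Lemma redex_mem rules a g c l r : redex rules a = Some (g, c, l, r) -> g \in rules.
Proof.
elim: rules => //= p rules IH; rewrite inE.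
case: p => [|[d b] p]; first by move/IH->; rewrite orbT.
by case: find_factor => [[? ?] [<- _ _ _]|/IH->]; rewrite ?eqxx ?orbT.
Qed.

(** A step is reversible because [X] is a rational subspace and the scaling factor is nonzero. Right
    to left yields new rules from S-polynomials; left to right yields a goal from its zero normal
    form. *)
Lemma valid_reduce rules n acc p : valid_rules rules ->
  valid (ncreduce n rules acc p) <-> valid (catrev acc p).
Proof.
move=> Hr; elim: n acc p => [|n IH] acc [|[c a] p] //=.
case R: redex => [[[[g cg] l] r]|]; last exact: IH.
set u := Z.div cg _; set v := Z.opp _.
have := ratZ_eq0 u; case: Z.eqb => // /negbT u0; rewrite IH.
have Hg := valid_shift v l r (Hr _ (redex_mem R)).
have E0 x : evalp (ncscale u acc) x + evalp (ncadd (ncscale u ((c, a) :: p)) (ncshift v l g r)) x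
    = ratZ u *: (evalp acc x + evalp ((c, a) :: p) x) + evalp (ncshift v l g r) x.
  by rewrite evalp_add !evalp_scale addrA -scalerDr.
split=> H x Ex; have {}H := H x Ex; have {}Hg := Hg x Ex; move: H; rewrite !evalp_catrev E0 => H.
  apply: (closed_scaleK u0); rewrite -[_ *: _](addrK (evalp (ncshift v l g r) x)).
  by rewrite addrC -scaleN1r; apply: XP.
exact: XP.
Qed.

Lemma valid_prim p : valid p -> valid (ncprim p).
Proof.
move=> Hp; rewrite /ncprim; set d := foldr _ _ _; set q := map _ _.
case: ifP => // /andP[d0 /eqP dq] x Ex.
have := Hp x Ex; rewrite -dq evalp_scale; apply: closed_scaleK.
by rewrite ratZ_eq0.
Qed.

Lemma valid_nth rules i : valid_rules rules -> valid (nth [::] rules i).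
Proof.
move=> Hr; have [lt_i|ge_i] := ltnP i (size rules); first exact/Hr/mem_nth.
by rewrite nth_default //; exact: valid_nil.
Qed.

Lemma valid_overlap f g k : valid f -> valid g -> valid (overlap f g k).
Proof.
case: f => [|[c a] f]; first by move=> *; exact: valid_nil.
case: g => [|[d b] g] Hf Hg; first exact: valid_nil.
rewrite /overlap; case: k => [|k]; last by apply: valid_add; apply: valid_shift.
case: find_factor => [[l r]|]; last exact: valid_nil.
by apply: valid_add; apply: valid_shift.
Qed.

Lemma valid_exec rules i : valid_rules rules -> valid_rules (exec rules i).
Proof.
move=> Hr p; rewrite /exec mem_rcons inE => /orP[/eqP->|/Hr //].
apply: valid_prim; case: i => [i j k|i].
  by apply/valid_reduce => //; apply: valid_overlap; apply: valid_nth.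
have := valid_nth i Hr; case: nth => [|m q] H; first exact: valid_nil.
exact/valid_reduce.
Qed.

Lemma valid_run rules script : valid_rules rules -> valid_rules (foldl exec rules script).
Proof. by elim: script rules => //= i script IH rules H; apply/IH/valid_exec. Qed.

Lemma derivesP rules script goals :
  valid_rules rules -> derives rules script goals -> valid_rules goals.
Proof.
rewrite /derives => /valid_run-/(_ script) Hr /allP Hg p /Hg /nilP Hp.
have [H _] := @valid_reduce _ fuel [::] p Hr.
by apply: H; rewrite Hp; exact: valid_nil.
Qed.

End Evaluation.

(** * The chain of ideals *)

(** For example, [[:: 4; 3; 3]] stands for t^4 w t^3 w t^3, and [[:: 0]] for 1. *)
Fixpoint tpow_word (s : seq nat) : word :=
  match s with
  | [::] => [::]
  | [:: n] => nseq n false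
  | n :: s' => nseq n false ++ true :: tpow_word s'
  end.

Definition ncW : ncpoly := [:: (1%BinZ, [:: true])].
Definition ncU : ncpoly := [:: (1, [:: false]); (1, [::])]%BinZ.
(** The geometric series of (1 + t)^-1, which is finite since t^5 = 0. *)
Definition ncUinv : ncpoly :=
  [seq ((if odd n then -1 else 1)%BinZ, nseq n false) | n <- rev (iota 0 5)].
Definition ncopp := ncscale (-1)%BinZ.

(** As w^2 = -1 in SL_2(Z), the relation (u w)^3 = 1 becomes u w u = w u^-1 w; taking inverses and
    w^-1 = eps w turns this into the last relation. *)
Definition base_relations (eps : Z) : seq ncpoly :=
  [:: [:: (1%BinZ, nseq 5 false)];
      [:: (1%BinZ, nseq 2 true); (Z.opp eps, [::])];
      ncadd (ncmul ncU (ncmul ncW ncU)) (ncopp (ncmul ncW (ncmul ncUinv ncW)));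
      ncadd (ncscale eps (ncmul ncUinv (ncmul ncW ncUinv))) (ncopp (ncmul ncW (ncmul ncU ncW)))].

(** Row j lists the coefficients of (u-1)^n w, n = 0..k, in an element that sends X^k to
    144 X^(k-j) Y^j.  Indeed w X^k = (-1)^k Y^k and log u = X d/dY, so X^(k-j) Y^j is a multiple of
    (log u)^(k-j) w X^k; expand (log u)^(k-j) in powers of u-1 (144 clears all denominators). *)
Definition monomial_table (k : nat) : seq (seq Z) :=
  match k with
  | 0 => [:: [:: 144]]%BinZ
  | 1 => [:: [:: 0; -144]; [:: -144; 0]]%BinZ
  | 2 => [:: [:: 0; 0; 72]; [:: 0; 72; -36]; [:: 144; 0; 0]]%BinZ
  | 3 => [:: [:: 0; 0; 0; -24]; [:: 0; 0; -24; 24]; [:: 0; -48; 24; -16]; [:: -144; 0; 0; 0]]%BinZ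
  | 4 => [:: [:: 0; 0; 0; 0; 6]; [:: 0; 0; 0; 6; -9]; [:: 0; 0; 12; -12; 11];
          [:: 0; 36; -18; 12; -9]; [:: 144; 0; 0; 0; 0]]%BinZ
  | _ => [::]
  end.

Definition monomial_op (k j : nat) : ncpoly :=
  let c := nth [::] (monomial_table k) j in
  ncsort [seq (nth 0%BinZ c n, rcons (nseq n false) true) | n <- iota 0 k.+1].

(** These elements annihilate X^k in Sym^k. They say that the operator for j = 0 acts as 144, that u
    sends X^(k-j) Y^j to X^(k-j) (X+Y)^j, and that w sends it to (-1)^(k-j) X^j Y^(k-j). *)
Definition sym_relations (k : nat) : seq ncpoly :=
  ncadd (monomial_op k 0) [:: (-144, [::])]%BinZ
  :: flatten [seq
      [:: ncsort (ncmul ncU (monomial_op k j) ++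
            flatten [seq ncscale (- Z.of_nat 'C(j, i))%BinZ (monomial_op k i)
                    | i <- iota 0 k.+1]);
          ncadd (ncmul ncW (monomial_op k j))
                (ncscale (if odd (k - j) then 1 else -1)%BinZ (monomial_op k (k - j)))]
    | j <- iota 0 k.+1].

(** [lsign] is the sign of eps ([true] for eps = -1), [ldeg] is k, [lgen] is p_j. *)
Record layer := Layer { lsign : bool; ldeg : nat; lgen : word; lscript : seq instr }.
Definition sgnZ (b : bool) : Z := if b then (-1)%BinZ else 1%BinZ.

(** The generators and the scripts were found by a computer search. *)
Definition layers : seq layer := [::
   Layer false 4 (tpow_word [:: 4; 3; 3])
     [:: Pair 1 2 1; Pair 0 4 4; Pair 5 0 1; Pair 4 1 1; Pair 5 4 1; Pair 8 6 2;
         Pair 4 8 2; Pair 8 9 2; Pair 10 9 6; Pair 8 11 5];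
   Layer false 2 (tpow_word [:: 4; 3])
     [:: Pair 1 2 1; Pair 0 5 4; Pair 6 0 1; Pair 5 1 1; Pair 6 5 1; Pair 9 7 2;
         Pair 5 9 2; Pair 11 10 6; Pair 4 5 0; Pair 13 6 4; Tail 13; Pair 15 1 1; Tail 11;
         Pair 10 16 7; Pair 9 18 5; Pair 17 16 5; Pair 1 20 1; Pair 19 21 0; Pair 5 22 3;
         Pair 6 23 3; Tail 9; Pair 25 24 2; Pair 24 26 1; Pair 26 25 5];
   Layer false 2 (tpow_word [:: 4; 1])
     [:: Pair 1 2 1; Pair 0 6 4; Pair 7 0 1; Pair 6 1 1; Pair 7 6 1; Pair 6 8 1;
         Pair 11 8 4; Pair 12 1 1; Pair 1 12 1; Pair 10 8 2; Pair 13 11 4; Pair 1 16 1;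
         Tail 16; Pair 17 7 4; Tail 18; Pair 1 19 1; Pair 17 1 1; Pair 22 20 5; Tail 22;
         Pair 23 1 1; Tail 23; Tail 24; Pair 7 25 4; Tail 26; Pair 7 29 1; Tail 27;
         Pair 25 31 4];
   Layer false 0 (tpow_word [:: 3; 1])
     [:: Pair 6 2 2; Pair 2 7 0; Pair 1 8 1; Pair 8 1 1; Tail 8; Pair 11 9 1; Pair 9 10 2;
         Pair 9 11 2; Pair 14 9 1; Pair 12 15 2; Pair 12 16 5; Pair 12 17 4; Pair 9 18 3;
         Pair 19 9 1; Pair 12 18 0];
   Layer false 2 (tpow_word [:: 2; 1])
     [:: Pair 7 2 2; Pair 8 7 4; Pair 8 9 0; Pair 2 8 0; Pair 11 1 1; Tail 11; Pair 1 12 1;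
         Pair 1 13 1; Pair 15 12 2; Pair 9 16 2];
   Layer false 0 (tpow_word [:: 0])
     [:: Pair 8 2 2; Pair 9 8 3; Pair 9 10 0; Pair 2 9 0; Pair 12 12 1; Pair 13 10 1;
         Pair 3 5 0; Pair 14 15 1; Pair 12 14 0];
   Layer true 3 (tpow_word [:: 4; 4; 2])
     [:: Pair 1 2 1; Pair 0 4 4; Pair 5 0 1; Pair 4 1 1; Pair 5 4 1; Pair 8 6 2;
         Pair 4 8 2; Pair 10 9 6; Pair 8 9 2; Pair 11 1 1];
   Layer true 1 (tpow_word [:: 4; 2])
     [:: Pair 1 2 1; Pair 0 5 4; Pair 6 0 1; Pair 5 1 1; Pair 6 5 1; Pair 9 7 2;
         Pair 5 9 2; Pair 4 2 0; Pair 12 10 7; Pair 13 1 1; Pair 10 14 7; Pair 9 15 5;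
         Pair 14 16 7; Pair 9 17 4; Tail 10; Pair 6 18 3; Pair 18 19 6];
   Layer true 3 (tpow_word [:: 3; 2])
     [:: Pair 1 2 1; Pair 0 6 4; Pair 7 0 1; Pair 6 1 1; Pair 7 6 1; Pair 3 5 0;
         Pair 11 1 1; Pair 1 12 1; Pair 12 8 3; Pair 10 8 2; Pair 1 15 1; Pair 16 12 1;
         Pair 17 1 1; Pair 1 17 1];
   Layer true 1 (tpow_word [:: 3])
     [:: Pair 1 2 1; Pair 0 7 4; Pair 8 0 1; Pair 7 1 1; Pair 9 6 3; Pair 7 6 4;
         Pair 12 6 3; Pair 1 13 1; Tail 13; Pair 8 15 4; Tail 15; Pair 17 14 2; Tail 17;
         Pair 19 18 2; Pair 7 18 0; Pair 21 18 1];
   Layer true 1 (tpow_word [:: 1])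
     [:: Pair 2 7 0; Pair 8 8 1; Pair 8 1 1; Pair 8 10 2; Pair 11 1 1; Tail 11;
         Pair 13 12 1; Pair 14 1 1; Pair 3 5 0]
  ].

(** Modulo the last generator t one has u = 1, so u w u = w u^-1 w gives w = w^2 = -1. Then 1 = w^2
    = -1, and nothing is left of the algebra for eps = -1. *)
Definition final_script : seq instr :=
  [:: Pair 2 7 0; Pair 1 9 0].

Definition layer_at (j : nat) : layer := nth (Layer false 0 [::] [::]) layers j.

(** Scripts index this list: 0 to 3 are the base relations, then come the earlier generators of the
    same sign, then the rules added by the script. *)
Definition known (b : bool) (j : nat) : seq ncpoly :=
  base_relations (sgnZ b) ++
  [seq [:: (1%BinZ, lgen (layer_at i))] | i <- iota 0 j & lsign (layer_at i) == b].

Definition layer_check (j : nat) : bool :=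
  let L := layer_at j in
  derives (known (lsign L) j) (lscript L)
    [seq ncshift 1%BinZ [::] p (lgen L) | p <- sym_relations (ldeg L)].

Lemma layers_ok : all layer_check (iota 0 11).
Proof. by vm_compute. Qed.

Lemma layers_final : derives (known true 11) final_script [:: [:: (1%BinZ, [::])]].
Proof. by vm_compute. Qed.

(** * Generators of SL_2(Z) *)

Definition mx2 (a b c d : int) : 'M[int]_2 :=
  \matrix_(i, j) if i == 0 then (if j == 0 then a else b) else (if j == 0 then c else d).

Lemma mx2E (g : 'M[int]_2) : g = mx2 (g 0 0) (g 0 1) (g 1 0) (g 1 1).
Proof.
by apply/matrixP => -[[|[|//]] Hi] [[|[|//]] Hj]; rewrite mxE /=; congr (g _ _); apply: val_inj.
Qed.

Lemma mx2M a b c d a' b' c' d' :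
  mx2 a b c d * mx2 a' b' c' d' =
  mx2 (a * a' + b * c') (a * b' + b * d') (c * a' + d * c') (c * b' + d * d').
Proof.
by apply/matrixP => i j; rewrite !mxE !big_ord_recl big_ord0 !mxE /= addr0; case: ifP; case: ifP.
Qed.

Lemma mx2_1 : 1 = mx2 1 0 0 1.
Proof. by apply/matrixP => -[[|[|//]] Hi] [[|[|//]] Hj]; rewrite !mxE. Qed.

Lemma det_mx2 a b c d : \det (mx2 a b c d) = a * d - b * c.
Proof.
rewrite (expand_det_row _ 0) !big_ord_recl big_ord0 /cofactor !det_mx11 !mxE /=.
by rewrite /bump /= expr0 expr1 !mul1r !mulN1r mulrN addr0.
Qed.

Definition mxU := mx2 1 1 0 1.
Definition mxW := mx2 0 1 (-1) 0.

Lemma SL2U : inSL2 mxU. Proof. by rewrite /inSL2 det_mx2; ring. Qed.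
Lemma SL2W : inSL2 mxW. Proof. by rewrite /inSL2 det_mx2; ring. Qed.
Lemma SL2_1 : inSL2 1. Proof. by rewrite /inSL2 det1. Qed.
Lemma SL2M g h : inSL2 g -> inSL2 h -> inSL2 (g * h).
Proof. by rewrite /inSL2 -mulmxE det_mulmx => -> ->; rewrite mulr1. Qed.

(** Euclid's algorithm on the first column. No inverses of the generators are needed, as both have
    finite order or are positive words in each other modulo (U W)^3 = 1 and W^4 = 1. *)
Lemma SL2_ind (P : 'M[int]_2 -> Prop) :
  P 1 ->
  (forall g, inSL2 g -> P g -> P (mxU * g)) ->
  (forall g, inSL2 g -> P g -> P (mxW * g)) ->
  forall g, inSL2 g -> P g.
Proof.
move=> P1 PU PW.
pose Q g := inSL2 g /\ P g.
have QU g : Q g -> Q (mxU * g) by case=> ? ?; split; [apply: SL2M SL2U _ | apply: PU].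
have QW g : Q g -> Q (mxW * g) by case=> ? ?; split; [apply: SL2M SL2W _ | apply: PW].
have QUn n g : Q g -> Q (mx2 1 n 0 1 * g).
  move=> Qg; case: n => [] n.
    elim: n => [|n IH]; first by rewrite -mx2_1 mul1r.
    rewrite (_ : mx2 _ _ _ _ = mxU * mx2 1 n 0 1) -?mulrA; first exact: QU.
    by rewrite mx2M; congr mx2; lia.
  elim: n => [|n /QW/QU/QW/QU/QW].
    (* Since (U W)^3 = 1, the inverse of U is the positive word W U W U W. *)
    have -> : mx2 1 (Negz 0) 0 1 = mxW * (mxU * (mxW * (mxU * mxW))).
      by rewrite !mx2M; congr mx2; lia.
    by rewrite -!mulrA; apply/QW/QU/QW/QU/QW.
  rewrite !mulrA; congr (Q (_ * _)).
  by rewrite !mx2M; congr mx2; lia.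
suff H n a b c d : (`|c| < n)%N -> a * d - b * c = 1 -> Q (mx2 a b c d).
  move=> g Hg; rewrite [g]mx2E.
  by case: (H (absz (g 1 0)).+1 (g 0 0) (g 0 1) (g 1 0) (g 1 1)) => //; rewrite -det_mx2 -mx2E.
elim: n a b c d => // n IH a b c d lt_c Hdet.
have Q1 : Q 1 by split => //; apply: SL2_1.
have [c0|c0] := eqVneq c 0.
  move: Hdet; rewrite c0 mulr0 subr0 => ad.
  have [[-> ->]|[-> ->]] : (a = 1 /\ d = 1) \/ (a = -1 /\ d = -1).
    have : (absz a * absz d)%N = 1%N by rewrite -abszM ad.
    move/eqP; rewrite muln_eq1 => /andP[/eqP a1 _].
    have [Ha|Ha] : a = 1 \/ a = -1 by lia.
      by left; rewrite Ha in ad; lia.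
    by right; rewrite Ha in ad; lia.
    by rewrite -[mx2 _ _ _ _]mulr1; apply: QUn.
  have := QUn (- b) _ (QW _ (QW _ Q1)); rewrite mulr1 !mx2M.
  by congr (Q (mx2 _ _ _ _)); lia.
have Ea := divz_eq a c; have := ltz_mod a c0; have := modz_ge0 a c0.
set q := (a %/ c)%Z in Ea *; set r := (a %% c)%Z in Ea * => r0 rc.
(* W^3 takes the matrix with rows (c, d), (-r, qd - b) to the one with rows (r, b - qd), (c, d), and
   U^q then restores the original; the lower left entry has dropped to -r. *)
have := IH c d (- r) (- (b - q * d)); case.
- by lia.
- by rewrite -Hdet Ea; ring.
move=> ? ?; have /QW/QW/QW/(QUn q) : Q (mx2 c d (- r) (- (b - q * d))) by [].
rewrite !mx2M; congr (Q (mx2 _ _ _ _)); rewrite ?Ea; ring.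
Qed.

(** * Symmetric powers *)

(** The value at (A, B) of the form of degree n whose dehomogenization at X = 1 is p. *)
Definition homogenize (n : nat) (p A B : {poly rat}) : {poly rat} :=
  \sum_(i < n.+1) p`_i *: (A ^+ (n - i) * B ^+ i).

Lemma homogenize_mul_linear n (p : {poly rat}) (a c : rat) (A B : {poly rat}) :
  (size p <= n.+1)%N ->
  homogenize n.+1 (p * (a%:P + c *: 'X)) A B = homogenize n p A B * (a *: A + c *: B).
Proof.
move=> sp; rewrite /homogenize mulrDr.
under eq_bigr do rewrite coefD coefMC -scalerAr coefZ coefMX scalerDl.
rewrite big_split /= [in X in X + _]big_ord_recr /= (nth_default _ sp) mul0r scale0r addr0.
rewrite [in X in _ + X]big_ord_recl /= mulr0 scale0r add0r.
rewrite mulrDr !mulr_suml; congr (_ + _); apply: eq_bigr => i _.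
  by rewrite -scalerAr -scalerAl scalerA (mulrC a) subSn -1?ltnS // exprSr mulrAC.
by rewrite /bump /= add1n subSS -scalerAr -scalerAl scalerA exprSr mulrA.
Qed.

Lemma size_linear (a c : rat) : (size (a%:P + c *: 'X)%R <= 2)%N.
Proof.
rewrite (leq_trans (size_polyD _ _)) // geq_max (leq_trans (size_polyC_leq1 _)) //=.
by rewrite (leq_trans (size_scale_leq _ _)) // size_polyX.
Qed.

Lemma size_linear_exp (a c : rat) n : (size ((a%:P + c *: 'X)%R ^+ n)%R <= n.+1)%N.
Proof.
apply: leq_trans (size_poly_exp_leq _ _) _.
by rewrite ltnS; have := size_linear a c; case: size => [|[|[|]]] //= _; rewrite ?mul0n ?mul1n.
Qed.

Lemma size_linear_exp_mul (a c b d : rat) m n :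
  (size ((a%:P + c *: 'X)%R ^+ m * (b%:P + d *: 'X)%R ^+ n)%R <= (m + n).+1)%N.
Proof.
apply: leq_trans (size_polyMleq _ _) _.
have := size_linear_exp a c m; have := size_linear_exp b d n; lia.
Qed.

Lemma homogenize_linear_exp m n (a c b d : rat) (A B : {poly rat}) :
  homogenize (m + n) ((a%:P + c *: 'X) ^+ m * (b%:P + d *: 'X) ^+ n) A B =
  (a *: A + c *: B) ^+ m * (b *: A + d *: B) ^+ n.
Proof.
elim: n => [|n IH].
  rewrite addn0 !expr0 !mulr1; elim: m => [|m IH].
    by rewrite /homogenize big_ord_recl big_ord0 !expr0 coefC /= mulr1 scale1r addr0.
  by rewrite !exprSr homogenize_mul_linear ?size_linear_exp // IH.
rewrite addnS !exprSr !mulrA homogenize_mul_linear ?IH //.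
exact: size_linear_exp_mul.
Qed.

Section SymAction.
Variable k : nat.

(** The linear forms attached to g h are those of h evaluated at the forms [Ag], [Bg] of g;
    expanding their product in the monomials of [Ag] and [Bg] gives the matrix product. *)
Lemma symk_coefM (g h : 'M[int]_2) (i j : 'I_k.+1) :
  symk_coef (g * h) i j = \sum_(l < k.+1) symk_coef h l j * symk_coef g i l.
Proof.
rewrite {1}/symk_coef.
set Ag := (g 0 0)%:~R%:P + (g 1 0)%:~R *: 'X : {poly rat}.
set Bg := (g 0 1)%:~R%:P + (g 1 1)%:~R *: 'X : {poly rat}.
have E (l : 'I_2) : ((g * h) 0 l)%:~R%:P + ((g * h) 1 l)%:~R *: 'X
    = (h 0 l)%:~R *: Ag + (h 1 l)%:~R *: Bg :> {poly rat}.
  rewrite !mxE !big_ord_recl !big_ord0 !addr0 /Ag /Bg.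
  rewrite (_ : lift ord0 ord0 = 1 :> 'I_2); last exact: val_inj.
  by rewrite !rmorphD !rmorphM /= -!mul_polyC !polyCD !polyCM; ring.
have j_le : (j <= k)%N by rewrite -ltnS.
rewrite !E -homogenize_linear_exp subnK // /homogenize coef_sum.
by apply: eq_bigr => l _; rewrite coefZ.
Qed.

Lemma symk_coef1 (i j : 'I_k.+1) : symk_coef 1 i j = (i == j)%:R.
Proof.
rewrite /symk_coef mx2_1 !mxE /= scale0r addr0 expr1n mul1r add0r scale1r coefXn.
by rewrite (inj_eq val_inj).
Qed.

Lemma symk_act1 (v : 'rV[rat]_k.+1) : symk_act 1 v = v.
Proof.
apply/rowP => i; rewrite mxE (bigD1 i) //= big1 ?addr0 => [|j ji].
  by rewrite symk_coef1 eqxx mulr1.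
by rewrite symk_coef1 eq_sym (negPf ji) mulr0.
Qed.

Lemma symk_actM (g h : 'M[int]_2) (v : 'rV[rat]_k.+1) :
  symk_act (g * h) v = symk_act g (symk_act h v).
Proof.
apply/rowP => i; rewrite [RHS]mxE.
under [RHS]eq_bigr => l _ do rewrite [symk_act h v 0 l]mxE mulr_suml.
rewrite mxE exchange_big /=; apply: eq_bigr => j _.
by rewrite symk_coefM mulr_sumr; apply: eq_bigr => l _; rewrite mulrA.
Qed.

Lemma symk_coefU (i j : 'I_k.+1) : symk_coef mxU i j = 'C(j, i)%:R.
Proof.
rewrite /symk_coef /mxU !mxE /= scale0r addr0 expr1n mul1r scale1r.
rewrite exprDn coef_sum.
under eq_bigr do rewrite expr1n mul1r coefMn coefXn.
have [le_ij|lt_ji] := leqP i j.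
  rewrite (bigD1 (Ordinal (le_ij : i < j.+1)%N)) //= eqxx big1 ?addr0 // => l Hl.
  by case: eqP => [E|_]; rewrite ?mul0rn //; case/eqP: Hl; apply: val_inj.
rewrite big1 ?bin_small // => l _; case: eqP => [E|_]; rewrite ?mul0rn //.
by have := ltn_ord l; rewrite -E; lia.
Qed.

Lemma symk_coefW (i j : 'I_k.+1) :
  symk_coef mxW i j = if i == (k - j)%N :> nat then (-1) ^+ (k - j) else 0.
Proof.
rewrite /symk_coef /mxW !mxE /= scale0r addr0 expr1n mulr1 add0r scaleN1r.
rewrite [(- 'X) ^+ _]exprNn -polyC1 -polyCN -polyC_exp coefCM coefXn.
by case: eqP => _; rewrite ?mulr1 ?mulr0.
Qed.
End SymAction.

(** * Isotypic quotients *)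

Section Submodule.
Variables (V : lmodType rat) (rho : 'M[int]_2 -> V -> V) (X : V -> Prop).
Hypothesis HX : is_submodule rho X.

Lemma submodule0 : X 0. Proof. by case: HX. Qed.

Lemma submoduleP a x y : X x -> X y -> X (a *: x + y).
Proof. by case: HX => _ + _; apply. Qed.

Lemma submodule_act g x : inSL2 g -> X x -> X (rho g x).
Proof. by case: HX => _ _; apply. Qed.

Lemma submoduleZ a x : X x -> X (a *: x).
Proof. by move=> Hx; rewrite -[_ *: _]addr0; apply: submoduleP => //; exact: submodule0. Qed.

Lemma submoduleD x y : X x -> X y -> X (x + y).
Proof. by move=> Hx Hy; rewrite -[x]scale1r; exact: submoduleP. Qed.

Lemma submoduleB x y : X x -> X y -> X (x - y).
Proof. by move=> Hx Hy; rewrite addrC -scaleN1r; exact: submoduleP. Qed.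

Lemma submodule_sum (I : eqType) (r : seq I) (F : I -> V) :
  (forall i, i \in r -> X (F i)) -> X (\sum_(i <- r) F i).
Proof.
elim: r => [|i r IH] H; first by rewrite big_nil; exact: submodule0.
rewrite big_cons; apply: submoduleD; first by apply: H; rewrite inE eqxx.
by apply: IH => j jr; apply: H; rewrite inE jr orbT.
Qed.

Lemma submodule_congr x y : X (x - y) -> X y -> X x.
Proof. by move=> Hxy Hy; rewrite -(subrK y x); exact: submoduleD. Qed.

Lemma submodule_trans y x z : X (x - y) -> X (y - z) -> X (x - z).
Proof. by move=> Hxy Hyz; rewrite -(subrKA y); exact: submoduleD. Qed.
End Submodule.

(** * Bases modulo a subspace *)

Section FreeModulo.
Variables (V : lmodType rat) (X S : V -> Prop).
Hypothesis (XP : forall a x y, X x -> X y -> X (a *: x + y)).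

Definition free_mod (A : set V) : Prop :=
  forall l : seq (V * rat), uniq (map fst l) -> (forall p, p \in l -> A p.1) ->
    X (\sum_(p <- l) p.2 *: p.1) -> forall p, p \in l -> p.2 = 0.

Lemma exists_basis_mod : X 0 ->
  exists A : set V, [/\ forall x, A x -> S x, free_mod A &
    forall e, S e -> exists2 l : seq (V * rat), (forall p, p \in l -> A p.1) &
      X (e - \sum_(p <- l) p.2 *: p.1)].
Proof.
move=> X0.
have [|A [[AS Afree] Amax]] := @Zorn_bigcup V (fun A => (forall x, A x -> S x) /\ free_mod A).
  move=> F FP Ftot; split=> [x [B /FP[BS _] /BS //]|l l_uniq lF Xl].
  (* A finite relation in the union of a chain lies in one member. The chain may be empty, whence
     the case of the empty relation. *)
  have [->|[B FB lB]] : l = [::] \/ exists2 B, F B & forall p, p \in l -> B p.1.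
    elim: l lF {l_uniq Xl} => [|p l IH] lF; [by left | right].
    have [B FB pB] := lF p (mem_head p l).
    have [|->|[C FC lC]] := IH; first by move=> q ql; apply: lF; rewrite inE ql orbT.
      by exists B => // q; rewrite mem_seq1 => /eqP->.
    have [BC|CB] := Ftot _ _ FB FC.
      by exists C => // q; rewrite inE => /orP[/eqP->|/lC //]; apply: BC.
    by exists B => // q; rewrite inE => /orP[/eqP->|/lC /CB].
    by [].
  by have [_] := FP _ FB; apply.
exists A; split=> // e Se.
have [Ae|nAe] := pselect (A e).
  exists [:: (e, 1)]; first by move=> p; rewrite mem_seq1 => /eqP->.
  by rewrite big_seq1 scale1r subrr.
pose B : set V := fun x => A x \/ x = e.
have /Amax nB : (A `<` B)%classic.
  by split=> [x|BA]; [left | apply: nAe; apply: BA; right].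
have {nB} nB : ~ free_mod B by move=> HB; apply: nB; split=> // x [/AS|->].
have [l [l_uniq lB Xl [p pl p0]]] : exists l : seq (V * rat),
    [/\ uniq (map fst l), forall p, p \in l -> B p.1, X (\sum_(p <- l) p.2 *: p.1) &
      exists2 p, p \in l & p.2 != 0].
  apply: contrapT => H; apply: nB => l l_uniq lB Xl p pl.
  apply/eqP; apply: contrapT => /negP p0; apply: H; exists l; split=> //.
  by exists p.
(* If e is absent or has coefficient 0, the relation lives in [A] and is trivial; otherwise it can
   be solved for e. *)
have [el|nel] := boolP (e \in map fst l); last first.
  case/eqP: p0; apply: Afree l_uniq _ Xl p pl => q ql; have [//|qe] := lB q ql.
  by case/negP: nel; rewrite -qe; apply: map_f.
have /mapP[[e' c] ecl /= ?] := el; subst e'.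
have l_perm := perm_to_rem ecl; set l' := rem _ l in l_perm.
move: l_uniq; rewrite (perm_uniq (perm_map fst l_perm)) /= => /andP[el' l'_uniq].
have l'A q : q \in l' -> A q.1.
  move=> ql'; have [//|qe] : B q.1 by apply: lB; rewrite (perm_mem l_perm) inE ql' orbT.
  by case/negP: el'; rewrite -qe; apply: map_f.
move: Xl; rewrite (perm_big _ l_perm) big_cons /= => Xl.
have [c0|c0] := eqVneq c 0.
  move: Xl; rewrite c0 scale0r add0r => Xl; case/eqP: p0.
  move: pl; rewrite (perm_mem l_perm) inE => /orP[/eqP-> //|].
  exact: Afree l'_uniq l'A Xl p.
exists [seq (q.1, - c^-1 * q.2) | q <- l'].
  by move=> q /mapP[q' /l'A ? ->].
rewrite big_map; under eq_bigr do rewrite /= -scalerA.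
rewrite -scaler_sumr scaleNr opprK -[e]scale1r -(mulVf c0) -scalerA -scalerDr.
by rewrite -[_ *: _]addr0; apply: XP.
Qed.
End FreeModulo.

Section SymMap.
Variables (V : lmodType rat) (k : nat) (F : nat -> V -> V) (e : V).

Definition sym_map (s : 'rV[rat]_k.+1) : V := \sum_(j < k.+1) s 0 j *: F j e.

Lemma sym_map_linear : linear sym_map.
Proof.
move=> a x y; rewrite /sym_map scaler_sumr -big_split; apply: eq_bigr => j _.
by rewrite !mxE scalerDl scalerA.
Qed.

HB.instance Definition _ := GRing.isLinear.Build rat _ V _ sym_map sym_map_linear.
End SymMap.

(** * Quotients generated by highest weight vectors *)

Section Isotypic.
Variables (V : lmodType rat) (rho : 'M[int]_2 -> V -> V).
Hypothesis Hrho : is_SL2_action rho.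
Variables (W' W S : V -> Prop) (k : nat) (F : nat -> V -> V) (D : rat).
Hypotheses (HW' : is_submodule rho W') (HW : is_submodule rho W).
Hypothesis D0 : D != 0.
Hypothesis SF : forall j e, S e -> W (F j e).
Hypothesis F0 : forall e, S e -> W' (F 0%N e - D *: e).
Hypothesis FU : forall e j, S e -> (j <= k)%N ->
  W' (rho mxU (F j e) - \sum_(i < k.+1) 'C(j, i)%:R *: F i e).
Hypothesis FW : forall e j, S e -> (j <= k)%N ->
  W' (rho mxW (F j e) - (-1) ^+ (k - j) *: F (k - j)%N e).
Hypothesis Sgen : forall X, is_submodule rho X ->
  (forall x, W' x -> X x) -> (forall x, S x -> X x) -> forall x, W x -> X x.

Lemma act_linear g : inSL2 g -> linear (rho g).
Proof. by case: Hrho => H _ _ /H. Qed.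

Lemma actZ g a x : inSL2 g -> rho g (a *: x) = a *: rho g x.
Proof.
move=> Hg; have lin := act_linear Hg.
have r0 : rho g 0 = 0 by have := lin (-1) 0 0; rewrite scaler0 addr0 scaleN1r addNr.
by have := lin a x 0; rewrite r0 !addr0.
Qed.

Lemma act_sum g (I : Type) (r : seq I) (v : I -> V) : inSL2 g ->
  rho g (\sum_(i <- r) v i) = \sum_(i <- r) rho g (v i).
Proof.
move=> Hg; elim: r => [|i r IH]; rewrite ?big_nil ?big_cons.
  by rewrite -[0](scale0r 0) actZ // !scale0r.
by rewrite -[v i]scale1r (act_linear Hg) IH !scale1r.
Qed.

Lemma actB g x y : inSL2 g -> rho g (x - y) = rho g x - rho g y.
Proof.
by move=> Hg; have := act_linear Hg (-1) y x; rewrite !scaleN1r ![- _ + _]addrC.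
Qed.

(** [F j e] plays the role of X^(k-j) Y^j, and [FU], [FW] are equivariance for the two generators;
    [SL2_ind] extends it to the group. *)
Lemma sym_map_equivariant e g s : S e -> inSL2 g ->
  W' (sym_map F e (symk_act g s) - rho g (sym_map (k := k) F e s)).
Proof.
move=> Se Hg; move: g Hg s.
suff step h : inSL2 h ->
    (forall j : 'I_k.+1, W' (rho h (F j e) - \sum_(i < k.+1) symk_coef h i j *: F i e)) ->
    forall g, inSL2 g ->
    (forall s, W' (sym_map F e (symk_act g s) - rho g (sym_map (k := k) F e s))) ->
    forall s, W' (sym_map F e (symk_act (h * g) s) - rho (h * g) (sym_map (k := k) F e s)).
  apply: SL2_ind => [s|g Hg IH|g Hg IH].
  - by case: Hrho => _ -> _; rewrite symk_act1 subrr; exact: (submodule0 HW').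
  - apply: step => // [|j]; first exact: SL2U.
    under eq_bigr do rewrite symk_coefU.
    by apply: FU; rewrite // -ltnS.
  - apply: step => // [|j]; first exact: SL2W.
    under eq_bigr do rewrite symk_coefW.
    have kj : (k - j < k.+1)%N by rewrite ltnS leq_subr.
    rewrite (bigD1 (Ordinal kj)) //= eqxx big1 ?addr0 => [|i].
      by apply: FW; rewrite // -ltnS.
    by rewrite -(inj_eq val_inj) /= => /negPf->; rewrite scale0r.
move=> Hh Fh g Hg IH s; case: (Hrho) => _ _ -> //; rewrite symk_actM.
have := submodule_act HW' Hh (IH s); rewrite actB //; apply: (submodule_trans HW').
move: (symk_act g s) => s'.
rewrite -opprB -scaleN1r; apply: (submoduleZ HW') => //.
rewrite /sym_map act_sum //; under [X in X - _]eq_bigr do rewrite actZ //.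
have -> : \sum_(j < k.+1) symk_act h s' 0 j *: F j e =
    \sum_(j < k.+1) s' 0 j *: \sum_(i < k.+1) symk_coef h i j *: F i e.
  under [RHS]eq_bigr do rewrite scaler_sumr.
  rewrite exchange_big; apply: eq_bigr => i _; rewrite mxE scaler_suml.
  by apply: eq_bigr => j _; rewrite scalerA.
rewrite -sumrB; apply: (submodule_sum HW') => // j _; rewrite -scalerBr.
exact: (submoduleZ HW').
Qed.

Definition shiftU (x : V) : V := rho mxU x - x.

Lemma shiftU_sum d (I : Type) (r : seq I) (c : I -> rat) (v : I -> V) :
  iter d shiftU (\sum_(i <- r) c i *: v i) = \sum_(i <- r) c i *: iter d shiftU (v i).
Proof.
elim: d => //= d ->; rewrite /shiftU act_sum; last exact: SL2U.
by rewrite -sumrB; apply: eq_bigr => i _; rewrite actZ ?scalerBr //; exact: SL2U.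
Qed.

Lemma shiftUB d x y : iter d shiftU (x - y) = iter d shiftU x - iter d shiftU y.
Proof.
elim: d => //= d ->; rewrite /shiftU actB; last exact: SL2U.
by rewrite !opprB addrACA [RHS]addrACA; congr (_ + _); rewrite addrC.
Qed.

Lemma shiftU_closed d x : W' x -> W' (iter d shiftU x).
Proof.
move=> Hx; elim: d => //= d IH; apply: (submoduleB HW') => //.
by apply: (submodule_act HW') => //; exact: SL2U.
Qed.

(** As u - 1 sends X^(k-j) Y^j to j X^(k-j+1) Y^(j-1) plus terms of lower degree in Y, its d-th
    power kills the monomials with j < d and sends X^(k-d) Y^d to d! X^k, here d! D e. *)
Lemma shiftU_top e d j : S e -> (j <= d <= k)%N ->
  W' (iter d shiftU (F j e) - (if j == d then d`!%:R * D else 0) *: e).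
Proof.
move=> Se; elim: d j => [|d IH] j /andP[jd dk].
  by move: jd; rewrite leqn0 => /eqP->; rewrite eqxx mul1r; exact: F0.
rewrite iterSr.
have Ht : W' (shiftU (F j e) - \sum_(i < j) 'C(j, i)%:R *: F i e).
  have := FU Se (leq_trans jd dk).
  rewrite -(big_mkord xpredT (fun i => 'C(j, i)%:R *: F i e)).
  rewrite (big_cat_nat (n := j.+1)) //= ?ltnS ?(leq_trans jd) //.
  have -> : \sum_(j.+1 <= i < k.+1) 'C(j, i)%:R *: F i e = 0.
    by rewrite big_nat_cond big1 // => i /andP[/andP[ji _] _]; rewrite bin_small // scale0r.
  by rewrite addr0 big_nat_recr //= binn scale1r big_mkord opprD addrA addrAC.
have := shiftU_closed d Ht; rewrite shiftUB shiftU_sum => /(submodule_trans HW'); apply.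
have -> : (if j == d.+1 then d.+1`!%:R * D else 0) *: e =
    \sum_(i < j) 'C(j, i)%:R *: ((if i == d :> nat then d`!%:R * D else 0) *: e).
  have [->|jd'] := eqVneq j d.+1.
    rewrite big_ord_recr /= eqxx big1 ?add0r => [|i _]; last first.
      by rewrite (ltn_eqF (ltn_ord i)) scale0r scaler0.
    by rewrite binSn scalerA factS natrM mulrA.
  rewrite scale0r big1 // => i _; rewrite ltn_eqF ?scale0r ?scaler0 //.
  by apply: leq_trans (ltn_ord i) _; rewrite -ltnS ltn_neqAle jd'.
rewrite -sumrB; apply: (submodule_sum HW') => // i _; rewrite -scalerBr.
apply: (submoduleZ HW') => //.
by apply: IH; rewrite (ltnW dk) andbT -ltnS (leq_trans (ltn_ord i)).
Qed.

(** The copies are indexed by a maximal subset of [S] independent modulo [W']. Their images span a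
    submodule containing [S], so [Sgen] gives surjectivity; powers of u - 1 reduce injectivity to
    that independence. *)
Lemma isotypic_quotient : quot_iso_sum_symk rho W' W k.
Proof.
have [A [AS Afree Aspan]] := exists_basis_mod S (submoduleP HW') (submodule0 HW').
pose I : eqType := {x : V | `[< A x >]}.
have IS (i : I) : S (val i) by apply: AS; apply/asboolP; exact: valP i.
pose f (i : I) : {linear 'rV[rat]_k.+1 -> V} := sym_map F (val i).
exists I, f; split.
- move=> i s; apply: (submodule_sum HW) => j _; apply: (submoduleZ HW); exact: SF.
- by move=> i g s Hg; exact: sym_map_equivariant.
- apply: Sgen; first split.
  + by exists [::]; rewrite /fam_sum big_nil subrr; exact: (submodule0 HW').
  + move=> a x y [lx Hx] [ly Hy].
    exists ([seq (p.1, a *: p.2) | p <- lx] ++ ly).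
    rewrite /fam_sum big_cat big_map /=.
    under eq_bigr do rewrite linearZ.
    by rewrite -scaler_sumr opprD addrACA -scalerBr; exact: (submoduleP HW').
  + move=> g x Hg [l Hl]; exists [seq (p.1, symk_act g p.2) | p <- l].
    have := submodule_act HW' Hg Hl; rewrite actB // => /(submodule_trans HW'); apply.
    rewrite -opprB -scaleN1r; apply: (submoduleZ HW') => //.
    rewrite /fam_sum big_map /=.
    rewrite act_sum // -sumrB; apply: (submodule_sum HW') => // p _.
    by apply: sym_map_equivariant => //; exact: IS.
  + by move=> x Wx; exists [::]; rewrite /fam_sum big_nil subr0.
  + move=> e Se; have [l lA] := Aspan e Se.
    elim: l e {Se} lA => [|p l IH] e lA; rewrite ?big_nil ?big_cons => He.
      by exists [::]; rewrite /fam_sum big_nil.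
    have [||l' Hl'] := IH (e - p.2 *: p.1).
    * by move=> q ql; apply: lA; rewrite inE ql orbT.
    * by rewrite -addrA -opprD.
    have Ap : `[< A p.1 >] by apply/asboolP/lA; rewrite mem_head.
    pose i : I := exist _ p.1 Ap.
    (* The vector [delta_mx 0 0] is X^k, whose image is D times the basis vector modulo [W']; hence
       the division by [D]. *)
    exists ((i, (p.2 / D) *: delta_mx 0 0) :: l').
    rewrite /fam_sum big_cons /= linearZ /=.
    have -> : sym_map F p.1 (delta_mx 0 0 : 'rV[rat]_k.+1) = F 0%N p.1.
      rewrite /sym_map big_ord_recl !mxE eqxx scale1r big1 ?addr0 // => j _.
      by rewrite mxE /= scale0r.
    have := submoduleP HW' (- (p.2 / D)) (F0 (IS i)) Hl'.
    rewrite scalerBr scalerA mulNr divfK // !scaleNr opprK addrA [_ + (e - _)]addrACA.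
    by rewrite addrN addr0 (addrC _ e) /fam_sum opprD addrA.
- move=> l l_uniq Hl.
  (* Descending induction on the degree in Y: the top m coefficients vanish in all components at
     once. *)
  suff H m (p : I * 'rV[rat]_k.+1) (j : 'I_k.+1) : p \in l -> (k.+1 - m <= j)%N -> p.2 0 j = 0.
    by move=> p pl; apply/rowP => j; rewrite mxE; apply: (H k.+1); rewrite ?subnn.
  elim: m p j => [|m IH] p j pl; first by rewrite subn0 leqNgt ltn_ord.
  have [/IH-> //|jm Hj] := leqP (k.+1 - m)%N j.
  have {}IH q (i : 'I_k.+1) : q \in l -> (j < i)%N -> q.2 0 i = 0.
    by move=> ql ji; apply: (IH q i ql); lia.
  have c0 : j`!%:R * D != 0 by rewrite mulf_neq0 // pnatr_eq0 -lt0n fact_gt0.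
  apply/(mulIf c0); rewrite mul0r.
  (* Once the coefficients above j vanish, (u - 1)^j turns the relation into this one between basis
     vectors. *)
  pose g (q : I * 'rV[rat]_k.+1) := (sval q.1, q.2 0 j * (j`!%:R * D)).
  have l2_fst : map fst (map g l) = map sval (map fst l) by rewrite -!map_comp.
  apply: (Afree (map g l) _ _ _ (g p)).
  + by rewrite l2_fst map_inj_uniq //; exact: val_inj.
  + by move=> q /mapP[q' _ ->]; apply/asboolP; exact: valP q'.1.
  + have := shiftU_closed j Hl.
    have -> : fam_sum (fun i => f i) l = \sum_(q <- l) 1 *: f q.1 q.2.
      by apply: eq_bigr => q _; rewrite scale1r.
    rewrite shiftU_sum => Hs; apply: (submodule_congr HW') Hs.
    rewrite big_map -sumrB; apply: (submodule_sum HW') => // q ql /=.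
    rewrite scale1r /sym_map shiftU_sum.
    have -> : (q.2 0 j * (j`!%:R * D)) *: sval q.1 = \sum_(i < k.+1)
        q.2 0 i *: ((if i == j :> nat then j`!%:R * D else 0) *: sval q.1).
      rewrite (bigD1 j) //= eqxx big1 ?addr0 ?scalerA // => i /negPf ij.
      by rewrite (inj_eq val_inj) ij scale0r scaler0.
    rewrite -sumrB; apply: (submodule_sum HW') => // i _.
    rewrite -scalerBr -opprB scalerN -scaleN1r.
    apply: (submoduleZ HW') => //; have [ij|ji] := leqP i j.
      by apply: (submoduleZ HW') => //; apply: (shiftU_top (IS q.1)); rewrite ij -ltnS ltn_ord.
    by rewrite (IH q) // scale0r; exact: (submodule0 HW').
  + by apply: map_f.
Qed.
End Isotypic.

(** * The ideal chain acting on a module *)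

Lemma unipotent_mxU : unipotent mxU.
Proof.
split; first exact: SL2U.
exists 2%N; have -> : mxU - 1 = mx2 0 1 0 0.
  by rewrite mx2_1; apply/matrixP => -[[|[|//]] Hi] [[|[|//]] Hj]; rewrite !mxE.
by rewrite expr2 mx2M; apply/matrixP => -[[|[|//]] Hi] [[|[|//]] Hj]; rewrite !mxE.
Qed.

Definition mxUinv := mx2 1 (-1) 0 1.

Lemma SL2Uinv : inSL2 mxUinv. Proof. by rewrite /inSL2 det_mx2; ring. Qed.

Section Layers.
Variables (V : lmodType rat) (rho : 'M[int]_2 -> V -> V).
Hypothesis Hrho : is_SL2_action rho.
Hypothesis Hunip : forall u, unipotent u ->
  forall x : V, iter 5 (fun y => rho u y - y) x = 0.

Lemma actM g h x : inSL2 g -> inSL2 h -> rho (g * h) x = rho g (rho h x).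
Proof. by case: Hrho => _ _ H ? ?; exact: H. Qed.

Lemma shiftU_linear : linear (shiftU rho).
Proof.
move=> a x y; rewrite /shiftU (act_linear Hrho SL2U) scalerBr.
by rewrite opprD addrACA.
Qed.

Definition opT : {linear V -> V} :=
  HB.pack (shiftU rho) (GRing.isLinear.Build rat V V _ (shiftU rho) shiftU_linear).
Definition opW : {linear V -> V} :=
  HB.pack (rho mxW) (GRing.isLinear.Build rat V V _ (rho mxW) (act_linear Hrho SL2W)).

Local Notation evalw := (evalw opT opW).
Local Notation evalp := (evalp opT opW).

Definition sign_space (b : bool) (v : V) : Prop := rho (mxW * mxW) v = ratZ (sgnZ b) *: v.

Lemma sign_spaceP b a x y : sign_space b x -> sign_space b y -> sign_space b (a *: x + y).
Proof.
move=> Hx Hy; rewrite /sign_space (act_linear Hrho (SL2M SL2W SL2W)) Hx Hy.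
by rewrite scalerDr !scalerA mulrC.
Qed.

Lemma sign_space_act b g x : inSL2 g -> sign_space b x -> sign_space b (rho g x).
Proof.
move=> Hg Hx; have HWW := SL2M SL2W SL2W.
rewrite /sign_space -actM //; have -> : mxW * mxW * g = g * (mxW * mxW).
  by rewrite [g]mx2E !mx2M; congr mx2; ring.
by rewrite actM // Hx actZ.
Qed.

Lemma sign_space_opT b x : sign_space b x -> sign_space b (opT x).
Proof.
move=> Hx; rewrite /= /shiftU addrC -scaleN1r; apply: sign_spaceP => //.
by apply: sign_space_act => //; exact: SL2U.
Qed.

Lemma sign_space_opW b x : sign_space b x -> sign_space b (opW x).
Proof. by apply: sign_space_act; exact: SL2W. Qed.

Lemma shiftU5 x :
  shiftU rho (shiftU rho (shiftU rho (shiftU rho (shiftU rho x)))) = 0.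
Proof. exact: Hunip unipotent_mxU x. Qed.

Lemma ratZ1 : ratZ 1 = 1. Proof. by []. Qed.

Lemma ratZN1 : ratZ (-1) = -1. Proof. by []. Qed.

Lemma evalpU x : evalp ncU x = rho mxU x.
Proof. by rewrite /= /shiftU ratZ1 !scale1r addr0 subrK. Qed.

Lemma evalpW x : evalp ncW x = rho mxW x.
Proof. by rewrite /= ratZ1 scale1r addr0. Qed.

Lemma evalpUinv x : evalp ncUinv x = rho mxUinv x.
Proof.
have UV : mxU * mxUinv = 1 by rewrite mx2M mx2_1; congr mx2; ring.
have act1 y : rho 1 y = y by case: Hrho.
rewrite -[x in LHS]act1 -UV actM; [|exact: SL2U|exact: SL2Uinv].
(* It remains to see that (t^4 - t^3 + t^2 - t + 1)(1 + t) = t^5 + 1 acts as the identity. *)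
move: (rho mxUinv x) => {}x.
have shiftUD y z : shiftU rho (y + z) = shiftU rho y + shiftU rho z.
  by rewrite -[y in LHS]scale1r shiftU_linear scale1r.
rewrite -evalpU /= !ratZ1 ratZN1 !scale1r !addr0.
move: (shiftU rho) shiftUD (shiftU5 x) => s sD s5.
rewrite !sD s5 !scaleN1r !opprD !addrA.
by rewrite add0r addrN sub0r addNr add0r addrN sub0r addNr add0r.
Qed.

Lemma valid_base b X : is_submodule rho X ->
  valid_rules opT opW (sign_space b) X (base_relations (sgnZ b)).
Proof.
move=> HX p; rewrite !inE => /or4P[]/eqP-> x Ex.
- by rewrite /= shiftU5 scaler0 addr0; exact: (submodule0 HX).
- have := Ex; rewrite /sign_space actM; [|exact: SL2W..] => /= ->.
  by rewrite ratZ1 scale1r ratZN scaleNr addr0 subrr; exact: (submodule0 HX).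
- rewrite evalp_add evalp_scale !evalp_mul !evalpU !evalpW evalpUinv ratZN1 scaleN1r.
  rewrite -!actM; try by do ?[exact: SL2U | exact: SL2W | exact: SL2Uinv | apply: SL2M].
  have -> : mxU * mxW * mxU = mxW * mxUinv * mxW by rewrite !mx2M.
  by rewrite subrr; exact: (submodule0 HX).
- rewrite evalp_add !evalp_scale !evalp_mul evalpU !evalpW !evalpUinv ratZN1 scaleN1r.
  rewrite -!actM; try by do ?[exact: SL2U | exact: SL2W | exact: SL2Uinv | apply: SL2M].
  have Hg : inSL2 (mxUinv * mxW * mxUinv).
    by do ?[exact: SL2U | exact: SL2W | exact: SL2Uinv | apply: SL2M].
  (* On the eigenspace the scalar eps is the action of w^2, which leaves an identity of matrices. *)
  rewrite -(sign_space_act Hg Ex) -actM //; last exact: SL2M SL2W SL2W.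
  have -> : mxW * mxW * (mxUinv * mxW * mxUinv) = mxW * mxU * mxW by rewrite !mx2M.
  by rewrite subrr; exact: (submodule0 HX).
Qed.

Definition contains_layers (j : nat) (X : V -> Prop) : Prop :=
  forall i v, (i < j)%N -> sign_space (lsign (layer_at i)) v -> X (evalw (lgen (layer_at i)) v).

(** The submodule I_j V, as the intersection of all submodules containing its generators. One chain
    serves both eigenspaces: six layers for w^2 = 1, then five for w^2 = -1. *)
Definition layer_series (j : nat) (x : V) : Prop :=
  forall X, is_submodule rho X -> contains_layers j X -> X x.

Lemma layer_series_submodule j : is_submodule rho (layer_series j).
Proof.
split=> [X HX _|a x y Hx Hy X HX HXj|g x Hg Hx X HX HXj].
- exact: submodule0 HX.
- by apply: (submoduleP HX); [apply: Hx | apply: Hy].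
- by apply: (submodule_act HX) => //; apply: Hx.
Qed.

Lemma layer_series_gen j : contains_layers j (layer_series j).
Proof. by move=> i v ij Hv X HX; apply. Qed.

Lemma submodule_opT X x : is_submodule rho X -> X x -> X (opT x).
Proof.
move=> HX Hx; apply: (submoduleB HX) => //.
by apply: (submodule_act HX) => //; exact: SL2U.
Qed.

Lemma submodule_opW X x : is_submodule rho X -> X x -> X (opW x).
Proof. by move=> HX Hx; apply: (submodule_act HX) => //; exact: SL2W. Qed.

Lemma submodule_evalp X p x : is_submodule rho X -> X x -> X (evalp p x).
Proof.
move=> HX Hx; elim: p => [|m p IH] /=; first exact: (submodule0 HX).
apply: (submoduleP HX) => //; apply: closed_evalw => // y.
  exact: submodule_opT.
exact: submodule_opW.
Qed.

Lemma derives_submodule b j script goals X :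
  is_submodule rho X -> contains_layers j X ->
  derives (known b j) script goals ->
  forall p x, p \in goals -> sign_space b x -> X (evalp p x).
Proof.
move=> HX HXj Hd p x Hp Hx.
apply: (derivesP (E := sign_space b)) Hd p Hp x Hx => //.
- exact: submodule0 HX.
- exact: (submoduleP HX).
- by move=> x; exact: submodule_opT.
- by move=> x; exact: submodule_opW.
- exact: sign_space_opT.
- exact: sign_space_opW.
move=> p; rewrite mem_cat => /orP[/(valid_base HX)//|/mapP[i]].
rewrite mem_filter mem_iota => /andP[/eqP Eb /andP[_ ij]] -> x Hx /=.
by rewrite ratZ1 scale1r addr0; apply: HXj => //; rewrite Eb.
Qed.

Lemma evalp_flatten (I : eqType) (r : seq I) (f : I -> ncpoly) x :
  evalp (flatten [seq f i | i <- r]) x = \sum_(i <- r) evalp (f i) x.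
Proof. by elim: r => [|i r IH] /=; rewrite ?big_nil // big_cons evalp_cat IH. Qed.

(** By [layers_ok] the vectors p_j v satisfy the relations of X^k modulo I_j V, as
    [isotypic_quotient] requires; [D] is the common factor 144 of [monomial_table]. *)
Lemma layer_quotient j : (j < 11)%N ->
  quot_iso_sum_symk rho (layer_series j) (layer_series j.+1) (ldeg (layer_at j)).
Proof.
move=> j11; set L := layer_at j; set k := ldeg L.
pose S e := exists2 v, sign_space (lsign L) v & e = evalw (lgen L) v.
have HL : layer_check j by apply: (allP layers_ok); rewrite mem_iota.
have rel p e : p \in sym_relations k -> S e -> layer_series j (evalp p e).
  move=> Hp [v Hv ->].
  have := derives_submodule (layer_series_submodule j) (@layer_series_gen j) HL (map_f _ Hp) Hv.
  by rewrite evalp_shift ratZ1 scale1r.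
apply: (@isotypic_quotient V rho Hrho _ _ S k (fun i => evalp (monomial_op k i)) 144%:R).
- exact: layer_series_submodule.
- exact: layer_series_submodule.
- by [].
- move=> i e [v Hv ->]; apply: (submodule_evalp _ (layer_series_submodule j.+1)).
  exact: layer_series_gen.
- by move=> e /(rel _ _ (mem_head _ _)); rewrite evalp_add /= addr0 -scaleNr.
- move=> e i Se ik.
  have : layer_series j (evalp (ncsort (ncmul ncU (monomial_op k i)
      ++ flatten [seq ncscale (- Z.of_nat 'C(i, l))%BinZ (monomial_op k l) | l <- iota 0 k.+1])) e).
    apply: rel => //; rewrite inE; apply/orP; right; apply/flatten_mapP.
    by exists i; rewrite ?mem_iota // mem_head.
  rewrite evalp_sort evalp_cat evalp_mul evalpU evalp_flatten.
  rewrite -[iota 0 k.+1]/(index_iota 0 k.+1) big_mkord.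
  congr (layer_series j (_ + _)); rewrite -sumrN; apply: eq_bigr => l _.
  by rewrite evalp_scale ratZN ratZ_nat scaleNr.
- move=> e i Se ik.
  have : layer_series j (evalp (ncadd (ncmul ncW (monomial_op k i))
      (ncscale (if odd (k - i) then 1 else -1)%BinZ (monomial_op k (k - i)))) e).
    apply: rel => //; rewrite inE; apply/orP; right; apply/flatten_mapP.
    by exists i; rewrite ?mem_iota // !inE eqxx orbT.
  rewrite evalp_add evalp_mul evalpW evalp_scale.
  congr (layer_series j (_ + _)); rewrite -scaleNr -signr_odd; congr (_ *: _).
  by case: odd.
- move=> X HX HjX SX x Hx; apply: Hx => // i v; rewrite ltnS leq_eqVlt => /orP[/eqP->|ij] Hv.
    by apply: SX; exists v.
  by apply: HjX; exact: layer_series_gen.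
Qed.

Lemma layer_series_top x : layer_series 11 x.
Proof.
move=> X HX HX11; have HWW := SL2M SL2W SL2W.
have WW2 y : rho (mxW * mxW) (rho (mxW * mxW) y) = y.
  by rewrite -actM // !mx2M; case: Hrho => _ H _; rewrite -[RHS]H mx2_1.
(* Layer 5, the last one for eps = 1, has the empty word as generator. *)
have Hplus v : sign_space false v -> X v by exact: (HX11 5%N v isT).
have Hminus v : sign_space true v -> X v.
  move=> Hv; have := derives_submodule HX HX11 layers_final (mem_head _ _) Hv.
  by rewrite /= ratZ1 scale1r addr0.
(* The projections to the two eigenspaces of the involution w^2. *)
have -> : x = 2^-1 *: (x + rho (mxW * mxW) x) + 2^-1 *: (x - rho (mxW * mxW) x).
  by rewrite -scalerDr addrACA subrr addr0 -[x + x]mulr2n -scaler_nat scalerA mulVf ?scale1r.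
apply: (submoduleD HX); apply: (submoduleZ HX).
  apply: Hplus; have := act_linear Hrho HWW 1 x (rho (mxW * mxW) x).
  by rewrite /sign_space !scale1r => ->; rewrite WW2 addrC.
by apply: Hminus; rewrite /sign_space (actB Hrho) // WW2 ratZN1 scaleN1r opprB.
Qed.

End Layers.

Theorem theorem1 (V : lmodType rat) (rho : 'M[int]_2 -> V -> V)
  (Hrho : is_SL2_action rho)
  (Hunip : forall u, unipotent u ->
     forall x : V, iter 5 (fun y => rho u y - y) x = 0) :
  exists (m : nat) (Vs : nat -> V -> Prop),
    [/\ (forall j, is_submodule rho (Vs j)),
        (forall x, Vs 0%N x <-> x = 0),
        (forall x, Vs m x),
        (forall j x, (j < m)%N -> Vs j x -> Vs j.+1 x) &
        (forall j, (j < m)%N ->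
           exists k : nat, (k <= 4)%N /\ quot_iso_sum_symk rho (Vs j) (Vs j.+1) k)].
Proof.
exists 11%N, (layer_series Hrho); split.
- exact: layer_series_submodule.
- move=> x; split=> [|->]; last exact: (submodule0 (layer_series_submodule Hrho 0)).
  (* With no generators imposed, the zero submodule is among those intersected. *)
  move/(_ (eq^~ 0)); apply; last by move=> ?.
  split=> [//|a y z -> ->|g y Hg ->]; first by rewrite scaler0 addr0.
  by rewrite -[in LHS](scale0r 0) (actZ Hrho) // scale0r.
- exact: layer_series_top.
- by move=> j x _ Hx X HX HXj; apply: Hx => // i v ij; apply: HXj; exact: leq_trans ij _.
- move=> j j11; exists (ldeg (layer_at j)); split; last exact: layer_quotient.
  have /allP := isT : all (fun i => ldeg (layer_at i) <= 4)%N (iota 0 11).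
  by apply; rewrite mem_iota.
Qed.
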